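(* Let $F$ be a field of characteristic $2$ and let $n\geq 2$ be an integer. If a pair of separably $(n-1)$-linked $n$-fold quadratic Pfister forms over $F$ are totally separably $1$-linked, then they are also inseparably $(n-1)$-linked. In particular, if a pair of $n$-fold quadratic Pfister forms over $F$ are totally separably $(n-1)$-linked, then they are inseparably $(n-1)$-linked.
   Context: Let $F$ be a field of characteristic $2$. Quadratic forms are considered up to isometry (equality means isometry). $[1,\beta]$ denotes the quadratic form $(x,y)\mapsto x^2+xy+\beta y^2$. A bilinear $m$-fold Pfister form is a symmetric bilinear form isometric to $\langle\!\langle\alpha_1,\dots,\alpha_m\rangle\!\rangle=\langle 1,\alpha_1\rangle\otimes\dots\otimes\langle 1,\alpha_m\rangle$ with $\alpha_i\in F^\times$ (the $0$-fold one is $\langle 1\rangle$), where $\langle a_1,\dots,a_r\rangle$ is the diagonal bilinear form. For a symmetric bilinear form $B$ on $V$ and a quadratic form $\varphi$ on $W$, $B\otimes\varphi$ is the quadratic form on $V\otimes_F W$ determined by $(B\otimes\varphi)(v\otimes w)=B(v,v)\varphi(w)$ (with polar form $B\otimes B_\varphi$). A quadratic $n$-fold Pfister form is a form $\langle\!\langle\alpha_1,\dots,\alpha_{n-1},\beta]\!]=\langle\!\langle\alpha_1,\dots,\alpha_{n-1}\rangle\!\rangle\otimes[1,\beta]$ with $\alpha_i\in F^\times$, $\beta\in F$. An $m$-fold quadratic Pfister form $\psi$ is a factor of an $n$-fold quadratic Pfister form $\pi$ if $\pi=B'\otimes\psi$ for some $(n-m)$-fold bilinear Pfister form $B'$; an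 $m$-fold bilinear Pfister form $B$ (with $m\le n-1$) is a factor of $\pi$ if $\pi=B\otimes\psi'$ for some $(n-m)$-fold quadratic Pfister form $\psi'$. Two $n$-fold quadratic Pfister forms are separably (resp. inseparably) $m$-linked if some $m$-fold quadratic (resp. bilinear) Pfister form is a factor of both. They are totally separably (resp. inseparably) $m$-linked if every $m$-fold quadratic (resp. bilinear) Pfister form is a factor of one if and only if it is a factor of the other. *)

(* Defs.v *)
From HB Require Import structures.
From mathcomp Require Import all_boot all_order all_algebra.
From mathcomp Require Import ring.

Set Implicit Arguments.
Unset Strict Implicit.
Unset Printing Implicit Defensive.

Import GRing.Theory.
Local Open Scope ring_scope.

(* Forms live on the coordinate spaces 'rV[F]_d; as every form on a
   d-dimensional space is isometric to one on 'rV[F]_d, and forms are only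
   compared up to isometry, this loses no generality. *)
Record bform (F : fieldType) := BForm {
  bdim : nat;
  bform_val :> {symmetric 'rV[F]_bdim} }.

Definition polar (F : fieldType) d (q : 'rV[F]_d -> F) (x y : 'rV[F]_d) : F :=
  q (x + y) - q x - q y.

Record qform (F : fieldType) := QForm {
  qdim : nat;
  qform_val :> 'rV[F]_qdim -> F;
  qformZ : forall a x, qform_val (a *: x) = a ^+ 2 * qform_val x;
  qform_polar : bilinear_for *%R *%R (polar qform_val) }.

Definition bisometric (F : fieldType) (B1 B2 : bform F) : Prop :=
  exists2 f : {linear 'rV[F]_(bdim B1) -> 'rV[F]_(bdim B2)},
    bijective f & isometry B2 B1 f.

Definition qisometric (F : fieldType) (q1 q2 : qform F) : Prop :=
  exists2 f : {linear 'rV[F]_(qdim q1) -> 'rV[F]_(qdim q2)},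
    bijective f & forall x, q2 (f x) = q1 x.

(* The space 'rV_m (x) 'rV_n is 'rV_(m * n), through the row-major encoding
   mxvec of m x n matrices, with v (x) w the encoding of v^T *m w. *)
Definition tens (F : fieldType) m n (v : 'rV[F]_m) (w : 'rV[F]_n) :
  'rV[F]_(m * n) := mxvec (v^T *m w).

(* Decomposing x : 'rV_(m * n) as \sum_i 'e_i (x) trow x i. *)
Definition trow (F : fieldType) m n (x : 'rV[F]_(m * n)) (i : 'I_m) : 'rV[F]_n :=
  row i (vec_mx x).

Section TensorRows.
Variables (F : fieldType) (m n : nat).

Lemma trowP a (x y : 'rV[F]_(m * n)) i :
  trow (a *: x + y) i = a *: trow x i + trow y i.
Proof. by rewrite /trow !linearP. Qed.

Lemma trow_tens (v : 'rV[F]_m) (w : 'rV[F]_n) i : trow (tens v w) i = v 0 i *: w.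
Proof.
by apply/rowP=> j; rewrite /trow /tens mxvecK !mxE big_ord1 !mxE.
Qed.

Lemma tens_sum (x : 'rV[F]_(m * n)) : x = \sum_i tens 'e_i (trow x i).
Proof.
apply: (can_inj vec_mxK); rewrite linear_sum /=.
apply/matrixP=> k j; rewrite summxE (bigD1 k) //= big1 ?addr0 => [|i ik].
  by rewrite /tens mxvecK !mxE big_ord1 !mxE !eqxx mul1r.
by rewrite /tens mxvecK !mxE big_ord1 !mxE eqxx /= eq_sym (negPf ik) mul0r.
Qed.
End TensorRows.


(* The diagonal bilinear form <s_0, ..., s_(r-1)>. *)
Section DiagonalForm.
Variables (F : fieldType) (s : seq F).

Definition diag_fun (x y : 'rV[F]_(size s)) : F :=
  \sum_(i < size s) s`_i * x 0 i * y 0 i.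

Fact diag_fun_sym x y : diag_fun x y = (-1) ^+ false * idfun (diag_fun y x).
Proof.
by rewrite expr0 mul1r /=; apply: eq_bigr => i _; rewrite mulrAC.
Qed.

Fact diag_fun_bilinear : bilinear_for *%R *%R diag_fun.
Proof.
have linr u : GRing.linear_for *%R (diag_fun u).
  move=> a x y; rewrite /diag_fun mulr_sumr -big_split /=.
  by apply: eq_bigr => i _; rewrite !mxE; ring.
split=> // u a x y.
by rewrite !(diag_fun_sym _ u) /= !expr0 !mul1r; apply: linr.
Qed.

HB.instance Definition _ :=
  @bilinear_isBilinear.Build F _ _ _ *%R *%R diag_fun diag_fun_bilinear.
HB.instance Definition _ :=
  @isHermitianSesquilinear.Build F _ false idfun diag_fun diag_fun_sym.

Definition bdiag : bform F := @BForm F (size s) diag_fun.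
End DiagonalForm.

(* B (x) C, determined by (v (x) w, v' (x) w') |-> B v v' * C w w'. *)
Section BilinearTensor.
Variables (F : fieldType) (B C : bform F).

Definition btens_fun (x y : 'rV[F]_(bdim B * bdim C)) : F :=
  \sum_i \sum_k B 'e_i 'e_k * C (trow x i) (trow y k).

Fact btens_fun_sym x y : btens_fun x y = (-1) ^+ false * idfun (btens_fun y x).
Proof.
rewrite expr0 mul1r /= /btens_fun exchange_big /=.
apply: eq_bigr => k _; apply: eq_bigr => i _.
by rewrite hermC [C _ _]hermC /= expr0 !mul1r.
Qed.

Fact btens_fun_bilinear : bilinear_for *%R *%R btens_fun.
Proof.
have linr u : GRing.linear_for *%R (btens_fun u).
  move=> a x y; rewrite /btens_fun mulr_sumr -big_split /=.
  apply: eq_bigr => i _; rewrite mulr_sumr -big_split /=.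
  by apply: eq_bigr => k _; rewrite trowP linearPr /=; ring.
split=> // u a x y.
by rewrite !(btens_fun_sym _ u) /= !expr0 !mul1r; apply: linr.
Qed.

HB.instance Definition _ :=
  @bilinear_isBilinear.Build F _ _ _ *%R *%R btens_fun btens_fun_bilinear.
HB.instance Definition _ :=
  @isHermitianSesquilinear.Build F _ false idfun btens_fun btens_fun_sym.

Definition btens : bform F := @BForm F (bdim B * bdim C) btens_fun.
End BilinearTensor.

Section FormTheory.
Variable F : fieldType.

Lemma bform_coord (B : bform F) v v' :
  B v v' = \sum_i \sum_k v 0 i * v' 0 k * B 'e_i 'e_k.
Proof.
rewrite {1}[v]row_sum_delta linear_sumlz; apply: eq_bigr => i _.
rewrite {1}[v']row_sum_delta linear_sumr; apply: eq_bigr => k _.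
by rewrite linearZl_LR linearZr_LR /=; ring.
Qed.

Lemma btens_tens (B C : bform F) v w v' w' :
  btens B C (tens v w) (tens v' w') = B v v' * C w w'.
Proof.
rewrite /= /btens_fun bform_coord mulr_suml; apply: eq_bigr => i _.
rewrite mulr_suml; apply: eq_bigr => k _.
by rewrite !trow_tens linearZl_LR linearZr_LR /=; ring.
Qed.

Lemma polarC d (q : 'rV[F]_d -> F) x y : polar q x y = polar q y x.
Proof. by rewrite /polar [x + y]addrC; ring. Qed.

Lemma qformD (q : qform F) x y : q (x + y) = q x + q y + polar q x y.
Proof. by rewrite /polar; ring. Qed.

Lemma polar_diag (q : qform F) x : polar q x x = q x *+ 2.
Proof. by rewrite /polar -mulr2n -scaler_nat qformZ; ring. Qed.

Lemma sum_ord_pairs d (G : 'I_d -> 'I_d -> F) :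
  \sum_i \sum_k G i k =
  \sum_i G i i + \sum_(i < d) \sum_(k < d | (i < k)%N) (G i k + G k i).
Proof.
have -> : \sum_(i < d) \sum_(k < d | (i < k)%N) (G i k + G k i) =
    \sum_(i < d) (\sum_(k < d | (i < k)%N) G i k + \sum_(k < d | (k < i)%N) G i k).
  rewrite big_split /= [X in _ = _ + X](exchange_big_dep xpredT) //=.
  by rewrite -big_split; apply: eq_bigr => i _; rewrite big_split.
rewrite -big_split; apply: eq_bigr => i _ /=.
rewrite (bigD1 i) //=; congr (_ + _).
rewrite (bigID (fun k : 'I_d => (i < k)%N)) /=; congr (_ + _);
  apply: eq_bigl => k; rewrite -(inj_eq val_inj) /=; by case: ltngtP.
Qed.
End FormTheory.

(* B (x) q, expanded on x = \sum_i 'e_i (x) x_i: the formula is forced by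
   qtens_tens and qtens_polar below. *)
Section QuadraticTensor.
Variables (F : fieldType) (B : bform F) (q : qform F).

Definition qtens_fun (x : 'rV[F]_(bdim B * qdim q)) : F :=
  \sum_i B 'e_i 'e_i * q (trow x i) +
  \sum_(i < bdim B) \sum_(k < bdim B | (i < k)%N) B 'e_i 'e_k * polar q (trow x i) (trow x k).

Fact qtens_funZ a x : qtens_fun (a *: x) = a ^+ 2 * qtens_fun x.
Proof.
have trowZ i : trow (a *: x) i = a *: trow x i by rewrite /trow !linearZ.
rewrite /qtens_fun mulrDr !mulr_sumr; congr (_ + _); apply: eq_bigr => i _.
  by rewrite trowZ qformZ mulrCA.
rewrite mulr_sumr; apply: eq_bigr => k _.
by rewrite !trowZ /polar -scalerDr !qformZ; ring.
Qed.

Lemma qtens_polar x y :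
  polar qtens_fun x y =
  \sum_i \sum_k B 'e_i 'e_k * polar q (trow x i) (trow y k).
Proof.
have [polDl polDr] := qform_polar q.
have pDl u v w : polar q (u + v) w = polar q u w + polar q v w.
  by have := polDl w 1 u v; rewrite scale1r /= mul1r.
have pDr w u v : polar q w (u + v) = polar q w u + polar q w v.
  by have := polDr w 1 u v; rewrite scale1r /= mul1r.
have trowD i : trow (x + y) i = trow x i + trow y i.
  by rewrite /trow !linearD.
rewrite sum_ord_pairs {1}/polar /qtens_fun.
rewrite [LHS](_ : _ = (\sum_i B 'e_i 'e_i * q (trow (x + y) i)
  - \sum_i B 'e_i 'e_i * q (trow x i) - \sum_i B 'e_i 'e_i * q (trow y i))
  + (\sum_(i < bdim B) \sum_(k < bdim B | (i < k)%N)
       B 'e_i 'e_k * polar q (trow (x + y) i) (trow (x + y) k)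
   - \sum_(i < bdim B) \sum_(k < bdim B | (i < k)%N) B 'e_i 'e_k * polar q (trow x i) (trow x k)
   - \sum_(i < bdim B) \sum_(k < bdim B | (i < k)%N) B 'e_i 'e_k * polar q (trow y i) (trow y k)));
  last by ring.
rewrite -!sumrB; congr (_ + _); apply: eq_bigr => i _.
  by rewrite trowD /polar; ring.
rewrite -!sumrB; apply: eq_bigr => k _.
rewrite !trowD !pDl !pDr [B 'e_k 'e_i]hermC /= expr0 mul1r.
by rewrite (polarC q (trow x k)); ring.
Qed.

Fact qtens_fun_polar : bilinear_for *%R *%R (polar qtens_fun).
Proof.
have linr u : GRing.linear_for *%R (polar qtens_fun u).
  move=> a x y; rewrite !qtens_polar mulr_sumr -big_split /=.
  apply: eq_bigr => i _; rewrite mulr_sumr -big_split /=.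
  by apply: eq_bigr => k _; rewrite trowP (qform_polar q).2 /=; ring.
by split=> // u a x y; rewrite !(polarC _ _ u); apply: linr.
Qed.

Definition qtens : qform F :=
  @QForm F (bdim B * qdim q) qtens_fun qtens_funZ qtens_fun_polar.

Lemma qtens_tens v w : qtens (tens v w) = B v v * q w.
Proof.
have [polDl polDr] := qform_polar q.
have pZ a b : polar q (a *: w) (b *: w) = a * b * (q w *+ 2).
  by rewrite /polar -scalerDl !qformZ; ring.
rewrite /= /qtens_fun bform_coord sum_ord_pairs mulrDl !mulr_suml.
congr (_ + _); apply: eq_bigr => i _; first by rewrite trow_tens qformZ; ring.
rewrite mulr_suml; apply: eq_bigr => k _.
by rewrite !trow_tens pZ [B 'e_k 'e_i]hermC /= expr0 mul1r; ring.
Qed.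
End QuadraticTensor.

(* The form [1, b]. *)
Section BinaryForm.
Variables (F : fieldType) (b : F).

Definition qbin_fun (x : 'rV[F]_2) : F :=
  x 0 0 ^+ 2 + x 0 0 * x 0 1 + b * x 0 1 ^+ 2.

Fact qbin_funZ a x : qbin_fun (a *: x) = a ^+ 2 * qbin_fun x.
Proof. by rewrite /qbin_fun !mxE; ring. Qed.

Fact qbin_fun_polar : bilinear_for *%R *%R (polar qbin_fun).
Proof. by split=> u a x y; rewrite /polar /qbin_fun !mxE /=; ring. Qed.

Definition qbin : qform F := @QForm F 2 qbin_fun qbin_funZ qbin_fun_polar.
End BinaryForm.

Section Pfister.
Variable F : fieldType.

(* <<s_0, ..., s_(m-1)>> *)
Definition bpfister (s : seq F) : bform F :=
  foldr (fun a => btens (bdiag [:: 1; a])) (bdiag [:: 1]) s.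

Definition is_bpfister (m : nat) (B : bform F) : Prop :=
  exists s : seq F,
    [/\ size s = m, 0 \notin s & bisometric B (bpfister s)].

(* There is no 0-fold quadratic Pfister form. *)
Definition is_qpfister (n : nat) (q : qform F) : Prop :=
  exists (s : seq F) (b : F),
    [/\ (size s).+1 = n, 0 \notin s
      & qisometric q (qtens (bpfister s) (qbin b))].

(* The factor relations are meant for p an n-fold quadratic Pfister form and
   q (resp. B) an m-fold quadratic (resp. bilinear) Pfister form. *)
Definition qfactor (m n : nat) (q p : qform F) : Prop :=
  (m <= n)%N /\
  exists2 B : bform F, is_bpfister (n - m) B & qisometric p (qtens B q).

Definition bfactor (m n : nat) (B : bform F) (p : qform F) : Prop :=
  (m < n)%N /\
  exists2 q : qform F, is_qpfister (n - m) q & qisometric p (qtens B q).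

Definition sep_linked (m n : nat) (p1 p2 : qform F) : Prop :=
  exists q, [/\ is_qpfister m q, qfactor m n q p1 & qfactor m n q p2].

Definition insep_linked (m n : nat) (p1 p2 : qform F) : Prop :=
  exists B, [/\ is_bpfister m B, bfactor m n B p1 & bfactor m n B p2].

Definition tot_sep_linked (m n : nat) (p1 p2 : qform F) : Prop :=
  forall q, is_qpfister m q -> (qfactor m n q p1 <-> qfactor m n q p2).
End Pfister.

(* Main.v *)
From HB Require Import structures.
Require Import Defs.
From mathcomp Require Import all_boot all_order all_algebra.
From mathcomp Require Import ring.

(** Separable (n-1)-linkage means that p1 = <<a>> Q and p2 = <<d>> Q for a common
    (n-1)-fold form Q = <<s, b]]. The form Q represents 1 at a vector e, and there is
    i with Q i = b and polar value 1 on (e, i).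

    For every t, the two-fold form <<a, b]] is isometric to <<a, b + a t^2]]
    ([dbl_bin_shift]), so [1, b + a t^2] is a factor of p1, hence of p2 by total
    separable 1-linkage. Now c = b + a t^2 can be made a value of a Q as well: for
    t = b + b / a one has c = a Q (t e + i). Comparing [1, c] with the unit vector of
    p2 yields a vector (x, w) with Q x + d Q w = c v^2, where v is the polar value of
    (e, x) ([contains_bin_trace]). Hence there is a relation
    Q x + d Q w = a Q y with (x, w) nonzero ([common_bin_relation]).

    Pfister forms are round: c Q = Q for every nonzero value c of Q ([round_dbl]).
    So in the generic case, where Q x, Q y and Q w are nonzero, multiplying the
    relation by Q x / (Q x)^2 and absorbing values of Q into a and d gives a = d + 1.
    But <<d + 1, b]] = <<d, b d / (d + 1)]] ([dbl_bin_succ]), so <<d, s>> is a bilinear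
    (n-1)-fold factor of both forms. In the degenerate cases either Q is isotropic,
    hence universal, and p1 = p2, or one of p1, p2 is <<1>> Q, which is hyperbolic and
    accepts any bilinear slot ([dbl1_bin]), or the relation itself makes p1 = p2
    ([relation_share_slots]).

    Total separable (n-1)-linkage implies both hypotheses, because a one-fold factor
    of an n-fold form extends to an (n-1)-fold factor ([tot_sep_linked1]).

    All of this is carried out with forms <<a>> Q realized on pairs (x, y) as
    Q x + a Q y, which makes the isometries explicit; [qtens_bpfister] identifies
    these iterated doublings with the tensor products. *)

Set Implicit Arguments.
Unset Strict Implicit.
Unset Printing Implicit Defensive.

Import GRing.Theory.
Local Open Scope ring_scope.

(** * Quadratic spaces *)

(** The polar form over an arbitrary module, so that a doubled form can live on
    pairs of vectors instead of on coordinates of a product space. *)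
Definition pol (F : fieldType) (V : lmodType F) (q : V -> F) (x y : V) : F :=
  q (x + y) - q x - q y.

Record qspace (F : fieldType) := QSpace {
  carrier : lmodType F;
  qval :> carrier -> F;
  qvalZ : forall a x, qval (a *: x) = a ^+ 2 * qval x;
  pol_linear : forall u, GRing.linear_for *%R (pol qval u) }.

Section QuadraticSpaces.
Variable F : fieldType.
Implicit Types (Q R S T : qspace F) (a b c d : F).

Lemma qvalD Q x y : Q (x + y) = Q x + Q y + pol Q x y.
Proof. by rewrite /pol; ring. Qed.

Lemma qval0 Q : Q 0 = 0.
Proof. by rewrite -(scale0r 0) qvalZ expr0n mul0r. Qed.

Lemma polC Q x y : pol Q x y = pol Q y x.
Proof. by rewrite /pol [x + y]addrC; ring. Qed.

Lemma polDr Q u x y : pol Q u (x + y) = pol Q u x + pol Q u y.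
Proof. by have := pol_linear u 1 x y; rewrite scale1r /= mul1r. Qed.

Lemma pol0r Q u : pol Q u 0 = 0.
Proof. by rewrite /pol addr0 qval0 subr0 subrr. Qed.

Lemma polZr Q u a x : pol Q u (a *: x) = a * pol Q u x.
Proof. by have := pol_linear u a x 0; rewrite !addr0 pol0r addr0. Qed.

Lemma polDl Q u x y : pol Q (x + y) u = pol Q x u + pol Q y u.
Proof. by rewrite !(polC _ u) polDr. Qed.

Lemma polZl Q u a x : pol Q (a *: x) u = a * pol Q x u.
Proof. by rewrite !(polC _ u) polZr. Qed.

Lemma polxx Q x : pol Q x x = Q x *+ 2.
Proof. by rewrite /pol -mulr2n -scaler_nat qvalZ; ring. Qed.

Definition qiso Q R : Prop :=
  exists f : carrier Q -> carrier R, exists g : carrier R -> carrier Q,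
  [/\ linear f, cancel f g, cancel g f & forall x, R (f x) = Q x].

Lemma qiso_refl Q : qiso Q Q.
Proof. by exists id, id; split. Qed.

Lemma qiso_sym Q R : qiso Q R -> qiso R Q.
Proof.
case=> f [g [lf fK gK fq]]; exists g, f; split=> // [a x y|x].
  by apply: (can_inj fK); rewrite lf !gK.
by rewrite -fq gK.
Qed.

Lemma qiso_trans R Q S : qiso Q R -> qiso R S -> qiso Q S.
Proof.
case=> f [g [lf fK gK fq]] [f' [g' [lf' fK' gK' fq']]].
exists (f' \o f), (g \o g'); split=> [a x y||| x] /=.
- by rewrite lf lf'.
- exact: can_comp.
- exact: can_comp.
- by rewrite fq' fq.
Qed.

Fact osumZ Q R a (z : (carrier Q * carrier R)%type) :
  Q (a *: z).1 + R (a *: z).2 = a ^+ 2 * (Q z.1 + R z.2).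
Proof. by rewrite /= !qvalZ mulrDr. Qed.

Lemma osum_pol Q R (u v : (carrier Q * carrier R)%type) :
  pol (fun z : (carrier Q * carrier R)%type => Q z.1 + R z.2) u v =
  pol Q u.1 v.1 + pol R u.2 v.2.
Proof. by rewrite /pol /=; ring. Qed.

Fact osum_linear Q R u : GRing.linear_for *%R
  (pol (fun z : (carrier Q * carrier R)%type => Q z.1 + R z.2) u).
Proof. by move=> a x y; rewrite !osum_pol /= !polDr !polZr; ring. Qed.

Definition osum Q R : qspace F :=
  @QSpace F (carrier Q * carrier R)%type _ (@osumZ Q R) (@osum_linear Q R).

Fact scaleqZ c Q a x : c * Q (a *: x) = a ^+ 2 * (c * Q x).
Proof. by rewrite qvalZ mulrCA. Qed.

Lemma scaleq_pol c Q u v : pol (fun x => c * Q x) u v = c * pol Q u v.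
Proof. by rewrite /pol; ring. Qed.

Fact scaleq_linear c Q u : GRing.linear_for *%R (pol (fun x => c * Q x) u).
Proof. by move=> a x y; rewrite !scaleq_pol polDr polZr /=; ring. Qed.

Definition scaleq c Q : qspace F :=
  QSpace (@scaleqZ c Q) (@scaleq_linear c Q).

Lemma osum_iso Q Q' R R' : qiso Q Q' -> qiso R R' -> qiso (osum Q R) (osum Q' R').
Proof.
case=> f [g [lf fK gK fq]] [f' [g' [lf' fK' gK' fq']]].
exists (fun z => (f z.1, f' z.2)), (fun z => (g z.1, g' z.2)).
by split=> [a x y|[x y]|[x y]|x] /=; rewrite ?lf ?lf' ?fK ?fK' ?gK ?gK' ?fq ?fq'.
Qed.

Lemma osumC Q R : qiso (osum Q R) (osum R Q).
Proof.
exists (fun z => (z.2, z.1)), (fun z => (z.2, z.1)).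
by split=> [a x y|[x y]|[x y]|x] //=; rewrite addrC.
Qed.

Lemma scaleq_iso c Q R : qiso Q R -> qiso (scaleq c Q) (scaleq c R).
Proof.
by case=> f [g [lf fK gK fq]]; exists f, g; split=> // x /=; rewrite fq.
Qed.

Lemma scaleqA c d Q : qiso (scaleq c (scaleq d Q)) (scaleq (c * d) Q).
Proof. by exists id, id; split=> // x /=; rewrite mulrA. Qed.

Lemma scaleqC c d Q : qiso (scaleq c (scaleq d Q)) (scaleq d (scaleq c Q)).
Proof. by exists id, id; split=> // x /=; rewrite mulrCA. Qed.

Lemma scale1q Q : qiso (scaleq 1 Q) Q.
Proof. by exists id, id; split=> // x /=; rewrite mul1r. Qed.

Lemma scaleq_osum c Q R : qiso (scaleq c (osum Q R)) (osum (scaleq c Q) (scaleq c R)).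
Proof. by exists id, id; split=> // x /=; rewrite mulrDr. Qed.

Lemma scaleq_sqr c d Q : d != 0 -> qiso (scaleq (c * d ^+ 2) Q) (scaleq c Q).
Proof.
move=> d0; exists ( *:%R d), ( *:%R d^-1); split=> [a x y|x|x|x] /=.
- by rewrite scalerDr !scalerA mulrC.
- by rewrite scalerA mulVf // scale1r.
- by rewrite scalerA divff // scale1r.
- by rewrite qvalZ mulrA.
Qed.

(** The bilinear forms <p, d> and <p + d, (p + d) p d> are isometric, through the
    orthogonal basis (1, 1), (d, -p) of the former. *)
Lemma binary_diag p d Q : p + d != 0 ->
  qiso (osum (scaleq (p + d) Q) (scaleq ((p + d) * (p * d)) Q))
       (osum (scaleq p Q) (scaleq d Q)).
Proof.
move=> pd0.
exists (fun z => (z.1 + d *: z.2, z.1 - p *: z.2)).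
exists (fun z => ((p + d)^-1 *: (p *: z.1 + d *: z.2), (p + d)^-1 *: (z.1 - z.2))).
split=> [a [x y] [x' y']|[x y]|[x y]|[x y]] /=.
- apply: injective_projections => /=.
    by rewrite !scalerDr !scalerA (mulrC d) addrACA.
  by rewrite !scalerDr !scalerN !scalerA (mulrC p) opprD addrACA.
- apply: injective_projections => /=.
    rewrite !scalerDr !scalerA !scalerN !scalerA addrACA -scalerDl -mulrDr.
    by rewrite mulVf // scale1r (mulrAC _ d) (mulrAC _ p) -!mulrA (mulrC d) subrr addr0.
  have -> : x + d *: y - (x - p *: y) = (p + d) *: y.
    by rewrite opprB addrA addrAC [x + _]addrC addrK addrC -scalerDl.
  by rewrite scalerA mulVf // scale1r.
- have E u v : p *: u + d *: v + d *: (u - v) = (p + d) *: u.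
    by rewrite scalerBr addrACA subrr addr0 scalerDl.
  have E' u v : p *: u + d *: v - p *: (u - v) = (p + d) *: v.
    by rewrite scalerBr opprB addrAC [p *: v - _]addrC addrA subrr add0r -scalerDl.
  rewrite !scalerA ![_ * (p + d)^-1]mulrC -!scalerA -scalerDr E -scalerBr E'.
  by rewrite !scalerA mulVf // !scale1r.
- by rewrite -scaleNr !qvalD !qvalZ !polZr; ring.
Qed.
End QuadraticSpaces.

(** * Iterated doubling *)

Section Doubling.
Variable F : fieldType.
Implicit Types (Q R : qspace F) (a b c d : F) (s : seq F).

(** This is <<a>> (x) Q, realized on pairs: no tensor product or cross term is
    needed because the bilinear form <1, a> is diagonal. *)
Definition dbl a Q : qspace F := osum Q (scaleq a Q).

Definition pform s Q : qspace F := foldr (@dbl) Q s.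

Lemma dbl_iso a Q R : qiso Q R -> qiso (dbl a Q) (dbl a R).
Proof. by move=> QR; apply: osum_iso => //; apply: scaleq_iso. Qed.

Lemma dbl_scaleq_iso a b Q :
  qiso (scaleq a Q) (scaleq b Q) -> qiso (dbl a Q) (dbl b Q).
Proof. by apply: osum_iso; apply: qiso_refl. Qed.

Lemma pform_iso s Q R : qiso Q R -> qiso (pform s Q) (pform s R).
Proof. by move=> QR; elim: s => //= a s; apply: dbl_iso. Qed.

Lemma dblC a b Q : qiso (dbl a (dbl b Q)) (dbl b (dbl a Q)).
Proof.
pose swap (V : lmodType F) (z : ((V * V) * (V * V))%type) :=
  ((z.1.1, z.2.1), (z.1.2, z.2.2)).
exists (@swap _), (@swap _).
by split=> [c x y|[[x y] [z t]]|[[x y] [z t]]|x] //=; ring.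
Qed.

(** Slots can be permuted; in particular the slot next to the binary form, the
    one affected by the isometries of two-fold forms, can be brought outside. *)
Lemma pform_dbl s a Q : qiso (pform s (dbl a Q)) (pform (a :: s) Q).
Proof.
elim: s => [|b s IH]; first exact: qiso_refl.
exact: qiso_trans (dbl_iso b IH) (dblC _ _ _).
Qed.

Definition round Q := forall x, Q x != 0 -> qiso (scaleq (Q x) Q) Q.

Definition nonsingular Q := forall x, x != 0 -> exists y, pol Q x y != 0.

Lemma round_absorb Q x c : round Q -> Q x != 0 ->
  qiso (scaleq (c * Q x) Q) (scaleq c Q).
Proof.
move=> rQ x0; apply: qiso_trans (qiso_sym (scaleqA _ _ _)) _.
by apply: scaleq_iso; apply: rQ.
Qed.

(** When both halves of (x, y) have nonzero values p and r, the bilinear form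
    (p + a r) <p, a r> is <1, p a r> up to squares, and the values p and r of Q
    are then absorbed, leaving <1, a>. *)
Lemma round_dbl a Q : round Q -> round (dbl a Q).
Proof.
move=> rQ [x y]; rewrite [dbl a Q (x, y)]/=.
set p := Q x; set r := Q y => pr0.
have [r0|r0] := eqVneq r 0.
  move: pr0; rewrite r0 mulr0 addr0 => p0.
  apply: qiso_trans (scaleq_osum _ _ _) _; apply: osum_iso; first exact: rQ.
  by apply: qiso_trans (scaleqC _ _ _) _; apply: scaleq_iso; apply: rQ.
have [p0|p0] := eqVneq p 0.
  move: pr0; rewrite p0 add0r => ar0.
  apply: qiso_trans (scaleq_osum _ _ _) _; apply: qiso_trans (osumC _ _) _.
  apply: osum_iso; last exact: round_absorb.
  have a0 : a != 0 by apply: contraNneq ar0 => ->; rewrite mul0r.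
  apply: qiso_trans (scaleqA _ _ _) _.
  rewrite (_ : a * r * a = 1 * a ^+ 2 * r); last by ring.
  apply: qiso_trans (round_absorb _ rQ r0) _.
  exact: qiso_trans (scaleq_sqr _ _ a0) (scale1q _).
have diag : qiso (osum (scaleq (p + a * r) Q)
    (scaleq ((p + a * r) * (p * (a * r))) Q)) (dbl a Q).
  apply: qiso_trans (binary_diag _ pr0) _.
  by apply: osum_iso; [apply: rQ|apply: round_absorb].
apply: qiso_trans diag; apply: qiso_trans (scaleq_osum _ _ _) _.
apply: osum_iso; first exact: qiso_refl.
apply: qiso_trans (scaleqA _ _ _) _; apply: qiso_sym.
rewrite (_ : (p + a * r) * (p * (a * r)) = (p + a * r) * a * r * p); last by ring.
exact: qiso_trans (round_absorb _ rQ p0) (round_absorb _ rQ r0).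
Qed.

Lemma nonsingular_dbl a Q : a != 0 -> nonsingular Q -> nonsingular (dbl a Q).
Proof.
move=> a0 ndQ [x y] xy0.
have [x0|/ndQ[z xz]] := eqVneq x 0; last first.
  by exists (z, 0); rewrite osum_pol /= scaleq_pol pol0r mulr0 addr0.
have /ndQ[z yz] : y != 0 by apply: contraNneq xy0 => ->; rewrite x0.
by exists (0, z); rewrite osum_pol /= scaleq_pol pol0r add0r mulf_neq0.
Qed.
End Doubling.

(** * The binary form [1, b] *)

Section Binary.
Variables (F : fieldType).
Implicit Types (a b c : F) (s : seq F) (Q : qspace F).

Definition bin_fun b (z : (F^o * F^o)%type) : F := z.1 ^+ 2 + z.1 * z.2 + b * z.2 ^+ 2.

Fact bin_funZ b a z : bin_fun b (a *: z) = a ^+ 2 * bin_fun b z.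
Proof. by rewrite /bin_fun /= /GRing.scale /=; ring. Qed.

Fact bin_fun_linear b u : GRing.linear_for *%R (pol (bin_fun b) u).
Proof. by move=> a x y; rewrite /pol /bin_fun /= /GRing.scale /=; ring. Qed.

Definition bin_space b : qspace F := QSpace (@bin_funZ b) (@bin_fun_linear b).

(** This says that the binary form [1, c] is a subform of Q. *)
Definition contains_bin Q c := exists g h, [/\ Q g = 1, Q h = c & pol Q g h = 1].

Lemma contains_bin_iso Q R c : qiso Q R -> contains_bin Q c -> contains_bin R c.
Proof.
case=> f [_ [lf _ _ fq]] [g [h [g1 hc gh]]]; exists (f g), (f h); split; rewrite ?fq //.
have fD : f (g + h) = f g + f h by have := lf 1 g h; rewrite !scale1r.
by rewrite -gh /pol -fD !fq.
Qed.

Lemma contains_bin_pform s c : contains_bin (pform s (bin_space c)) c.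
Proof.
elim: s => [|a s [g [h [g1 hc gh]]]].
  by exists (1, 0), (0, 1); split=> /=; rewrite /pol /bin_fun /=; ring.
exists (g, 0), (h, 0); rewrite osum_pol /= !qval0 scaleq_pol pol0r !mulr0 !addr0.
by split.
Qed.
End Binary.

Lemma round_bin (F : fieldType) (b : F) : round (bin_space b).
Proof.
move=> [p q] /=; rewrite /bin_fun /=.
have [m Em] : exists m, m = p ^+ 2 + p * q + b * q ^+ 2.
  by exists (p ^+ 2 + p * q + b * q ^+ 2).
rewrite -Em => m0.
(* multiplication by p + q i in F[i], where i ^ 2 = i - b, has norm m *)
exists (fun z => (p * z.1 - b * q * z.2, q * z.1 + (p + q) * z.2)).
exists (fun z => (m^-1 * ((p + q) * z.1 + b * q * z.2), m^-1 * (p * z.2 - q * z.1))).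
have m2 (x : F) : m^-1 * (m * x) = x by rewrite mulKf.
split=> [a [x y] [x' y']|[x y]|[x y]|[x y]] /=.
- by apply: injective_projections; rewrite /= /GRing.scale /=; ring.
- by apply: injective_projections => /=; rewrite -[RHS]m2 Em; congr (_ * _); ring.
- by apply: injective_projections => /=; rewrite -[RHS]m2 [X in _ = _ * (X * _)]Em; ring.
- by rewrite /bin_fun Em /=; ring.
Qed.

(** * Two-fold forms in characteristic 2 *)

Section Linkage.
Variables (F : fieldType).
Hypothesis charF2 : 2%N \in [pchar F].
Implicit Types (a b c d : F) (s : seq F) (Q : qspace F).

(** In characteristic 2, an identity is checked by the ring normalizer once the
    discarded even part is supplied as z. *)
Lemma eq_mod2 (z x y : F) : x = y + z *+ 2 -> x = y.
Proof. by rewrite mulr2n addrr_pchar2 // addr0. Qed.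

Lemma pol_alt Q x : pol Q x x = 0.
Proof. by rewrite polxx mulr2n addrr_pchar2. Qed.

Lemma nonsingular_bin b : nonsingular (bin_space b).
Proof.
move=> [p q] pq0.
have P1 : pol (bin_space b) (p, q) (1, 0) = q.
  by rewrite /pol /= /bin_fun /=; apply: (@eq_mod2 p); ring.
have P2 : pol (bin_space b) (p, q) (0, 1) = p.
  by rewrite /pol /= /bin_fun /=; apply: (@eq_mod2 (b * q)); ring.
have [p0|p0] := eqVneq p 0; last by exists (0, 1); rewrite P2.
by exists (1, 0); rewrite P1; apply: contraNneq pq0 => ->; rewrite p0.
Qed.

(** In the quaternion algebra generated by i and j with i^2 + i = b, j^2 = a and
    j i = (i + 1) j, the element i + t j also has trace 1 and j-commutator j, and its
    norm is b + a t^2; the map is the change of basis from 1, i, j, i j to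
    1, i + t j, j, (i + t j) j. *)
Lemma dbl_bin_shift a b t : qiso (dbl a (bin_space (b + a * t ^+ 2))) (dbl a (bin_space b)).
Proof.
exists (fun z => ((z.1.1 + z.2.2 * t * a, z.1.2), (z.2.1 + z.1.2 * t, z.2.2))).
exists (fun z => ((z.1.1 - z.2.2 * t * a, z.1.2), (z.2.1 - z.1.2 * t, z.2.2))).
split=> [c [[x y] [z w]] [[x' y'] [z' w']]|[[x y] [z w]]|[[x y] [z w]]|[[p q] [r s]]] /=.
- by congr (_, _); apply: injective_projections; rewrite /= /GRing.scale /=; ring.
- by rewrite !addrK.
- by rewrite !subrK.
- rewrite /bin_fun /=.
  by apply: (@eq_mod2 (p * s * t * a + s * t * a * q + a * r * q * t)); ring.
Qed.

(** The inseparable generators j and j + 1 have squares a + 1 and a when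
    j^2 = a + 1, so they generate the same quadratic extension. The new binary
    form is that of k = i + i j^-1, an element with k (j + 1) = (j + 1) (k + 1) and
    norm b (1 + 1 / (a + 1)); the map is written in the basis 1, k, j + 1,
    k (j + 1). *)
Lemma dbl_bin_succ a b : a != 0 -> a + 1 != 0 ->
  qiso (dbl a (bin_space (b * a / (a + 1)))) (dbl (a + 1) (bin_space b)).
Proof.
move=> a0 d0.
exists (fun z => ((z.1.1 + z.2.1, z.1.2), (z.2.1, (z.1.2 + z.2.2 * a) / (a + 1)))).
exists (fun z => ((z.1.1 - z.2.1, z.1.2), (z.2.1, ((a + 1) * z.2.2 - z.1.2) / a))).
split=> [c [[x y] [z w]] [[x' y'] [z' w']]|[[x y] [z w]]|[[x y] [z w]]|[[p q] [r s]]] /=.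
- by congr (_, _); apply: injective_projections; rewrite /= /GRing.scale /=; ring.
- by congr (_, _); apply: injective_projections => /=; field; rewrite ?a0 ?d0.
- by congr (_, _); apply: injective_projections => /=; field; rewrite ?a0 ?d0.
- rewrite /bin_fun /=.
  apply: (@eq_mod2 (p * r + r ^+ 2 + r * q + b * q ^+ 2 / (a + 1) + b * q * s * a / (a + 1))).
  by field.
Qed.

(** Both sides are hyperbolic: the left one because [1, b] is doubled, the right
    one because [1, 0] is a hyperbolic plane. *)
Lemma dbl1_bin a b : a != 0 -> qiso (dbl 1 (bin_space b)) (dbl a (bin_space 0)).
Proof.
move=> a0.
exists (fun z => ((z.1.1 + z.2.1, z.2.2),
  (z.1.2 + z.2.2, (b * (z.1.2 + z.2.2) + z.1.1) / a - (z.1.2 + z.2.2)))).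
exists (fun z => ((a * (z.2.1 + z.2.2) - b * z.2.1, z.2.1 - z.1.2),
  (z.1.1 - (a * (z.2.1 + z.2.2) - b * z.2.1), z.1.2))).
split=> [c [[x y] [z w]] [[x' y'] [z' w']]|[[x y] [z w]]|[[x y] [z w]]|[[p q] [r s]]] /=.
- by congr (_, _); apply: injective_projections; rewrite /= /GRing.scale /=; ring.
- by congr (_, _); apply: injective_projections => /=; field.
- by congr (_, _); apply: injective_projections => /=; field.
- rewrite /bin_fun /=.
  by apply: (@eq_mod2 (p * r + p * s + b * q * s)); field.
Qed.

(** * The relation produced by a common binary subform *)

Lemma isotropic_universal Q x c : nonsingular Q -> x != 0 -> Q x = 0 ->
  exists z, Q z = c.
Proof.
move=> ndQ /ndQ[y xy] x0; exists ((c - Q y) / pol Q x y *: x + y).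
by rewrite qvalD qvalZ x0 polZl mulr0 add0r divfK // addrC subrK.
Qed.

Lemma round_pform s b : round (pform s (bin_space b)).
Proof. by elim: s => [|a s IH]; [apply: round_bin|apply: round_dbl]. Qed.

Lemma nonsingular_pform s b : 0 \notin s -> nonsingular (pform s (bin_space b)).
Proof.
elim: s => [|a s IH]; first by move=> _; apply: nonsingular_bin.
by rewrite inE negb_or eq_sym => /andP[a0 /IH]; apply: nonsingular_dbl.
Qed.

(** Let 1, i be the standard basis of [1, c]. If g, h span a copy of [1, c] in Q,
    then the plane spanned by (g, 1) and (h, i) in the orthogonal sum of Q and [1, c]
    is totally isotropic, and the vector (e, 1) is isotropic as well. A vector of the
    plane orthogonal to (e, 1) and not proportional to it projects to y, after adding
    a multiple of e. This plays the role of Witt cancellation of a hyperbolic plane. *)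
Lemma contains_bin_trace Q e c : Q e = 1 -> contains_bin Q c ->
  exists2 y, y != 0 & Q y = c * pol Q e y ^+ 2.
Proof.
move=> e1 [g [h [g1 hc gh]]].
have [eg|eg] := eqVneq (pol Q e g) 0; last first.
  set r := pol Q e g in eg; pose y := (1 + pol Q e h) *: g + r *: h + (1 + pol Q e h) *: e.
  have ey : pol Q e y = r.
    rewrite /y !polDr !polZr pol_alt -/r.
    by apply: (@eq_mod2 (r * pol Q e h)); ring.
  exists y; first by apply: contraNneq eg => y0; rewrite -ey y0 pol0r.
  rewrite ey /y !qvalD !qvalZ polDl !polZl !polZr g1 hc e1 gh.
  rewrite ![pol _ _ e]polC -/r; set k := pol Q e h.
  by apply: (@eq_mod2 ((1 + k) ^+ 2 + (1 + k) * r * (1 + k))); ring.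
have [ge|ge] := eqVneq g e.
  exists h; last by rewrite -ge gh expr1n mulr1.
  by apply/eqP => h0; move: gh; rewrite h0 pol0r => /esym/eqP; rewrite oner_eq0.
exists (g - e); first by rewrite subr_eq0.
have eg_e : pol Q e (g - e) = 0 by rewrite -scaleN1r polDr polZr eg pol_alt mulr0 addr0.
rewrite eg_e -scaleN1r qvalD qvalZ polZr polC eg g1 e1.
by apply: (@eq_mod2 1); ring.
Qed.

(** The constant t = b + b / a is the solution of a (t + b) = b; it makes
    c = b + a t^2 equal to a (t^2 + t + b) = a Q (t e + i). Thus c is at the same time
    a constant for which [1, c] lies in <<a>> Q and a value of a Q, so that the vector
    of [contains_bin_trace] relates values of Q, d Q and a Q. *)
Lemma common_bin_relation a d b Q e i :
    a != 0 -> d != 0 -> Q e = 1 -> Q i = b -> pol Q e i = 1 ->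
    contains_bin (dbl d Q) (b + a * (b + b / a) ^+ 2) ->
  exists x w y, Q x + d * Q w = a * Q y /\ (x != 0) || (w != 0).
Proof.
move=> a0 d0 e1 ib ei cb.
have [|[x w] xw0 Ry] := contains_bin_trace (e := (e, 0) : carrier (dbl d Q)) _ cb.
  by rewrite /= e1 qval0 mulr0 addr0.
move: Ry; rewrite osum_pol /= scaleq_pol [pol Q 0 _]polC pol0r mulr0 addr0.
set v := pol Q e x => Ry.
exists x, w, (v *: ((b + b / a) *: e + i)); split; last first.
  by apply: contraNT xw0; rewrite negb_or !negbK => /andP[/eqP-> /eqP->].
rewrite Ry qvalZ qvalD qvalZ e1 ib polZl ei.
by apply: (@eq_mod2 (- a * b * v ^+ 2)); field.
Qed.

(** * Changing the slots of linked Pfister forms *)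

Section Pfister.
Variables (s : seq F) (b : F).
Hypothesis s0 : 0 \notin s.
Let Q := pform s (bin_space b).

Lemma dbl_value_iso a x m : Q x != 0 -> m != 0 ->
  qiso (dbl (a * Q x / m ^+ 2) Q) (dbl a Q).
Proof.
move=> x0 m0; apply: dbl_scaleq_iso; rewrite -exprVn.
apply: qiso_trans (scaleq_sqr _ _ _) _; first by rewrite invr_eq0.
by apply: round_absorb => //; apply: round_pform.
Qed.

Definition share_slots a d := exists (t : seq F) (b1 b2 : F),
  [/\ size t = (size s).+1, 0 \notin t, qiso (dbl a Q) (pform t (bin_space b1))
    & qiso (dbl d Q) (pform t (bin_space b2))].

Lemma share_slots_sym a d : share_slots a d -> share_slots d a.
Proof. by case=> t [b1 [b2 [st t0 i1 i2]]]; exists t, b2, b1. Qed.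

Lemma share_slots_eq a d : a != 0 -> qiso (dbl d Q) (dbl a Q) -> share_slots a d.
Proof.
move=> a0 da; exists (a :: s), b, b; split=> //.
- by rewrite inE eq_sym negb_or a0.
- exact: qiso_refl.
Qed.

Lemma share_slots_bin c a b1 d b2 : c != 0 ->
  qiso (dbl c (bin_space b1)) (dbl a (bin_space b)) ->
  qiso (dbl c (bin_space b2)) (dbl d (bin_space b)) ->
  share_slots a d.
Proof.
move=> c0 i1 i2.
have E a' b' : qiso (dbl c (bin_space b')) (dbl a' (bin_space b)) ->
    qiso (dbl a' Q) (pform (c :: s) (bin_space b')).
  move=> /qiso_sym i; apply: qiso_trans (qiso_sym (pform_dbl _ _ _)) _.
  by apply: qiso_trans (pform_iso s i) (pform_dbl _ _ _).
exists (c :: s), b1, b2; split=> //; try exact: E.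
by rewrite inE eq_sym negb_or c0.
Qed.

Lemma share_slots_iso a a' d d' :
    qiso (dbl a' Q) (dbl a Q) -> qiso (dbl d' Q) (dbl d Q) ->
  share_slots a' d' -> share_slots a d.
Proof.
move=> ia id [t [b1 [b2 [st t0 i1 i2]]]]; exists t, b1, b2; split=> //.
  exact: qiso_trans (qiso_sym ia) i1.
exact: qiso_trans (qiso_sym id) i2.
Qed.

(** The form <<1>> Q is hyperbolic, so it accepts any slot. *)
Lemma share_slots1 a : a != 0 -> share_slots 1 a.
Proof.
move=> a0.
exact: share_slots_bin a0 (qiso_sym (dbl1_bin b a0)) (qiso_refl _).
Qed.

(** If Q is isotropic, it is universal and the slots a and d are interchangeable.
    Otherwise roundness lets a and d be multiplied by values of Q, and the relation
    says that they can be chosen with difference 1, unless they can be chosen equal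
    or one of them can be chosen to be 1. *)
Lemma relation_share_slots a d x w y : a != 0 -> d != 0 ->
  Q x + d * Q w = a * Q y -> (x != 0) || (w != 0) -> share_slots a d.
Proof.
move=> a0 d0 rel xw0.
have ndQ : nonsingular Q by apply: nonsingular_pform.
have common z z' : Q z != 0 -> Q z' != 0 -> d * Q z' = a * Q z -> share_slots a d.
  move=> z0 z'0 dz; apply: share_slots_eq => //; apply: dbl_scaleq_iso.
  have rQ : round Q by apply: round_pform.
  apply: qiso_trans (qiso_sym (round_absorb _ rQ z'0)) _.
  by rewrite dz; apply: round_absorb.
have isotropic z : z != 0 -> Q z = 0 -> share_slots a d.
  move=> z0 Qz; have [u Qu] := isotropic_universal d ndQ z0 Qz.
  have [u' Qu'] := isotropic_universal a ndQ z0 Qz.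
  by apply: (common u u'); rewrite ?Qu ?Qu' // mulrC.
have [x0|x0] := eqVneq x 0.
  move: rel xw0; rewrite x0 qval0 add0r eqxx /= => rel w0.
  have [/(isotropic _ w0)//|Qw0] := eqVneq (Q w) 0.
  apply: (common y w) => //.
  by apply: contraNneq Qw0 => Qy; move/eqP: rel; rewrite Qy mulr0 mulf_eq0 (negPf d0).
have [/(isotropic _ x0)//|m0] := eqVneq (Q x) 0.
(* scaling the relation by m turns its first term into the square m ^ 2 *)
have [f [_ [_ _ _ fq]]] : qiso (scaleq (Q x) Q) Q by exact: round_pform m0.
set m := Q x in rel m0 fq.
have {}rel : m ^+ 2 + d * Q (f w) = a * Q (f y).
  by rewrite !fq /= !(mulrCA _ m) -rel; ring.
have square c z : c * Q z = m ^+ 2 -> qiso (dbl 1 Q) (dbl c Q).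
  move=> cz; have Qz : Q z != 0.
    by apply: contraNneq m0 => Qz; move/eqP: cz; rewrite Qz mulr0 eq_sym expf_eq0.
  by have := dbl_value_iso c Qz m0; rewrite cz divff // expf_neq0.
have [y0|y0] := eqVneq (Q (f y)) 0.
  have i1 : qiso (dbl 1 Q) (dbl d Q).
    apply: (square _ (f w)); move: rel; rewrite y0 mulr0 addrC => /eqP.
    rewrite addr_eq0 => /eqP ->.
    by rewrite oppr_pchar2.
  apply: share_slots_sym.
  exact: share_slots_iso i1 (qiso_refl _) (share_slots1 a0).
have [w0|w0] := eqVneq (Q (f w)) 0.
  have i1 : qiso (dbl 1 Q) (dbl a Q).
    by apply: (square _ (f y)); rewrite -rel w0 mulr0 addr0.
  exact: share_slots_iso i1 (qiso_refl _) (share_slots1 d0).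
set A := d * Q (f w) / m ^+ 2.
have A0 : A != 0 by rewrite !mulf_neq0 ?invr_eq0 ?expf_neq0.
have A1 : a * Q (f y) / m ^+ 2 = A + 1 by rewrite -rel mulrDl divff ?expf_neq0 // addrC.
apply: share_slots_iso (dbl_value_iso a y0 m0) (dbl_value_iso d w0 m0) _.
rewrite A1 -/A; apply: share_slots_bin A0 (dbl_bin_succ b A0 _) (qiso_refl _).
by rewrite -A1 !mulf_neq0 ?invr_eq0 ?expf_neq0.
Qed.

Lemma common_bins_share_slots a d : a != 0 -> d != 0 ->
  (forall c t, qiso (dbl a Q) (pform t (bin_space c)) ->
     size t = (size s).+1 -> 0 \notin t -> contains_bin (dbl d Q) c) ->
  share_slots a d.
Proof.
move=> a0 d0 H; have [e [i [e1 ib ei]]] := contains_bin_pform s b.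
have [|x [w [y [rel xw0]]]] := common_bin_relation (Q := Q) a0 d0 e1 ib ei.
  apply: (H _ (a :: s)) => //; last by rewrite inE eq_sym negb_or a0.
  apply: qiso_trans (qiso_sym (pform_dbl _ _ _)) _.
  apply: qiso_trans (pform_iso s _) (pform_dbl _ _ _).
  exact: qiso_sym (dbl_bin_shift _ _ _).
exact: relation_share_slots rel xw0.
Qed.
End Pfister.
End Linkage.

(** * Tensor products as iterated doublings *)

Section Bridge.
Variable F : fieldType.
Implicit Types (B C : bform F) (q p : qform F) (s : seq F).

Definition of_qform q : qspace F :=
  @QSpace F 'rV[F]_(qdim q) q (@qformZ F q) (@qform_polar F q).2.

Lemma qisometricP p q : qisometric p q <-> qiso (of_qform p) (of_qform q).
Proof.
split=> [[f [g fK gK] fq]|[f [g [lf fK gK fq]]]].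
  by exists f, g; split=> // a x y; rewrite linearP.
pose f' : {linear 'rV[F]_(qdim p) -> 'rV[F]_(qdim q)} :=
  HB.pack f (GRing.isLinear.Build F _ _ _ f lf).
by exists f'; [exists g|].
Qed.

Lemma pol_suml (Q : qspace F) I (r : seq I) (f : I -> carrier Q) v :
  pol Q (\sum_(i <- r) f i) v = \sum_(i <- r) pol Q (f i) v.
Proof.
by apply: (big_morph (fun u => pol Q u v)); [move=> x y; exact: polDl|rewrite polC pol0r].
Qed.

Lemma pol_sumr (Q : qspace F) I (r : seq I) (f : I -> carrier Q) v :
  pol Q v (\sum_(i <- r) f i) = \sum_(i <- r) pol Q v (f i).
Proof. by rewrite polC pol_suml; apply: eq_bigr => i _; rewrite polC. Qed.

(** This is M (x) id, where M acts on row vectors from the right. *)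
Definition tmap m m' n (M : 'M[F]_(m, m')) (x : 'rV[F]_(m * n)) : 'rV[F]_(m' * n) :=
  mxvec (M^T *m vec_mx x).

Section Tmap.
Variables m m' n : nat.

Lemma tmapP (M : 'M[F]_(m, m')) : linear (@tmap m m' n M).
Proof. by move=> a x y; rewrite /tmap !linearP. Qed.

Lemma tmapD (M N : 'M[F]_(m, m')) (x : 'rV_(m * n)) :
  tmap (M + N) x = tmap M x + tmap N x.
Proof. by rewrite /tmap linearD mulmxDl linearD. Qed.

Lemma tmap_tens (M : 'M[F]_(m, m')) v (w : 'rV[F]_n) :
  tmap M (tens v w) = tens (v *m M) w.
Proof. by rewrite /tmap /tens mxvecK trmx_mul mulmxA. Qed.

Lemma tmap_sum (M : 'M[F]_(m, m')) (x : 'rV[F]_(m * n)) :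
  tmap M x = \sum_i tens ('e_i *m M) (trow x i).
Proof.
rewrite {1}[x]tens_sum (big_morph (tmap M) (id1 := 0) (op1 := +%R)).
- by apply: eq_bigr => i _; rewrite tmap_tens.
- by move=> u v; have := tmapP M 1 u v; rewrite !scale1r.
- by rewrite /tmap linear0 mulmx0 linear0.
Qed.
End Tmap.

Lemma tmap1 m n (x : 'rV[F]_(m * n)) : tmap 1%:M x = x.
Proof. by rewrite /tmap trmx1 mul1mx vec_mxK. Qed.

Lemma tmap0 m m' n (x : 'rV[F]_(m * n)) : tmap (0 : 'M_(m, m')) x = 0.
Proof. by rewrite /tmap trmx0 mul0mx linear0. Qed.

Lemma tmapM m m' m'' n (M : 'M[F]_(m, m')) (N : 'M_(m', m'')) (x : 'rV[F]_(m * n)) :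
  tmap N (tmap M x) = tmap (M *m N) x.
Proof. by rewrite /tmap mxvecK trmx_mul mulmxA. Qed.

Lemma row_mulmx_inj m n (M N : 'M[F]_(m, n)) :
  (forall v : 'rV_m, v *m M = v *m N) -> M = N.
Proof. by move=> MN; apply/row_matrixP=> i; rewrite !rowE. Qed.

Lemma qtens_pol_tens B q v w v' w' :
  polar (qtens B q) (tens v w) (tens v' w') = B v v' * polar q w w'.
Proof.
rewrite qtens_polar bform_coord mulr_suml; apply: eq_bigr => i _.
rewrite mulr_suml; apply: eq_bigr => k _; rewrite !trow_tens.
rewrite -![polar q _ _]/(pol (of_qform q) _ _) polZl polZr; ring.
Qed.

Lemma qtens_pol_tmap B q m m' (M : 'M[F]_(m, bdim B)) (N : 'M[F]_(m', bdim B))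
    (x : 'rV[F]_(m * qdim q)) y :
  polar (qtens B q) (tmap M x) (tmap N y) =
  \sum_i \sum_k B ('e_i *m M) ('e_k *m N) * polar q (trow x i) (trow y k).
Proof.
rewrite -![polar (qtens _ _) _ _]/(pol (of_qform (qtens _ _)) _ _) !tmap_sum.
rewrite pol_suml; apply: eq_bigr => i _; rewrite pol_sumr; apply: eq_bigr => k _.
exact: qtens_pol_tens.
Qed.

(** The two sides have the same polar form, so their difference is additive; it
    vanishes on pure tensors, which generate the space. *)
Lemma qtens_tmap a B C q (M : 'M[F]_(bdim B, bdim C)) :
    (forall v v', C (v *m M) (v' *m M) = a * B v v') ->
  forall x, qtens C q (tmap M x) = a * qtens B q x.
Proof.
move=> CB x; apply/eqP; rewrite -subr_eq0; apply/eqP.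
pose D y := qtens C q (tmap M y) - a * qtens B q y.
have DD y z : D (y + z) = D y + D z.
  have tD : tmap M (y + z) = tmap M y + tmap M z.
    by have := tmapP M 1 y z; rewrite !scale1r.
  rewrite /D tD !qformD qtens_pol_tmap // qtens_polar.
  under eq_bigr do under eq_bigr do rewrite CB -mulrA.
  under eq_bigr do rewrite -mulr_sumr.
  by rewrite -mulr_sumr; ring.
have D0 : D 0 = 0 by apply: (addrI (D 0)); rewrite -DD !addr0.
rewrite -/(D x) [x]tens_sum (big_morph D DD D0) big1 // => i _.
by rewrite /D tmap_tens !qtens_tens CB; ring.
Qed.

Lemma qtens_bisometric B C q : bisometric B C ->
  qiso (of_qform (qtens B q)) (of_qform (qtens C q)).
Proof.
case=> f [g fK gK] fBC; pose M := lin1_mx f; pose N := \matrix_i g 'e_i.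
have vM v : v *m M = f v by rewrite mul_rV_lin1.
have NM : N *m M = 1%:M.
  by apply/row_matrixP=> i; rewrite row_mul vM rowK gK row1.
have MN : M *m N = 1%:M.
  apply: row_mulmx_inj => v; apply: (can_inj fK).
  by rewrite -!vM !mulmxA -(mulmxA _ N) NM !mulmx1.
exists (tmap M), (tmap N); split=> [|x|x|x] /=.
- exact: tmapP.
- by rewrite tmapM MN tmap1.
- by rewrite tmapM NM tmap1.
- rewrite -[RHS]mul1r; apply: (@qtens_tmap 1 B C) => v v'.
  by rewrite mul1r !vM fBC.
Qed.

(** The space of the left-hand side is the sum of the images of the maps
    v (x) w |-> (e_j (x) v) (x) w for j = 0, 1, which are orthogonal because the bilinear
    form <1, a> is diagonal. *)
Lemma qtens_btens_diag a C q :
  qiso (of_qform (qtens (btens (bdiag [:: 1; a]) C) q)) (dbl a (of_qform (qtens C q))).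
Proof.
set B := bdiag _; pose m := bdim C.
pose j0 : 'I_(bdim B) := @Ordinal 2 0 isT; pose j1 : 'I_(bdim B) := @Ordinal 2 1 isT.
pose M (j : 'I_(bdim B)) : 'M[F]_(m, bdim B * m) := lin1_mx (mxvec \o mulmx ('e_j)^T).
pose P (j : 'I_(bdim B)) : 'M[F]_(bdim B * m, m) := lin1_mx (row j \o vec_mx).
have vM j v : v *m M j = tens 'e_j v by rewrite mul_rV_lin1.
have zP j z : z *m P j = trow z j by rewrite mul_rV_lin1.
have MP j k : M j *m P k = (j == k)%:R%:M.
  apply: row_mulmx_inj => v; rewrite mulmxA vM zP trow_tens mul_mx_scalar.
  by rewrite !mxE eqxx eq_sym.
have PM : P j0 *m M j0 + P j1 *m M j1 = 1%:M.
  apply: row_mulmx_inj => z; rewrite mulmxDr !mulmxA !zP !vM mulmx1.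
  rewrite [RHS]tens_sum (_ : \sum_i _ = \sum_(i < 2) tens 'e_(i : 'I_(bdim B)) (trow z i)) //.
  rewrite 2!big_ord_recl big_ord0 addr0.
  by congr (tens 'e_ _ (trow z _) + tens 'e_ _ (trow z _)); apply: val_inj.
have BM j k v v' : btens B C (v *m M j) (v' *m M k) = B 'e_j 'e_k * C v v'.
  by rewrite !vM btens_tens.
apply: qiso_sym.
exists (fun z => tmap (M j0) z.1 + tmap (M j1) z.2), (fun z => (tmap (P j0) z, tmap (P j1) z)).
have tD k k' n (L : 'M[F]_(k, k')) (x y : 'rV_(k * n)) : tmap L (x + y) = tmap L x + tmap L y.
  by have := tmapP L 1 x y; rewrite !scale1r.
split=> [c [x y] [x' y']|[x y]|z|[x y]] /=.
- by rewrite !tmapP scalerDr addrACA.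
- by rewrite !tD !tmapM !MP /= !tmap1 !raddf0 !tmap0 addr0 add0r.
- by rewrite !tmapM -tmapD PM tmap1.
rewrite -[LHS]/(qtens (btens B C) q (_ + _)) qformD qtens_pol_tmap //.
have BE j k : B 'e_j 'e_k = (j == k)%:R * [:: 1; a]`_j.
  rewrite /= /diag_fun (bigD1 j) //= big1 => [|i ij].
    by rewrite !mxE !eqxx /= addr0 !mulr1 mulrC eq_sym.
  by rewrite !mxE /= (negPf ij) mulr0 mul0r.
rewrite (qtens_tmap (a := 1) (B := C)) => [|v v']; last by rewrite BM BE eqxx !mul1r.
rewrite (qtens_tmap (a := a) (B := C)) => [|v v']; last by rewrite BM BE eqxx mul1r.
rewrite mul1r [X in _ + X]big1 ?addr0 // => i _; rewrite big1 // => k _.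
by rewrite BM BE !mul0r.
Qed.

Lemma qtens_bdiag1 q : qiso (of_qform (qtens (bdiag [:: 1]) q)) (of_qform q).
Proof.
pose j0 : 'I_(bdim (bdiag [:: 1 : F])) := @Ordinal 1 0 isT.
apply: qiso_sym.
exists (fun w => tens 'e_j0 w), (fun x => trow x j0); split=> [a x y|w|x|w] /=.
- by rewrite /tens !linearP.
- by rewrite trow_tens !mxE !eqxx scale1r.
- rewrite [RHS]tens_sum (big_ord1 _ (fun i => tens 'e_i (trow x i))).
  by congr (tens 'e_ _ (trow x _)); apply: val_inj.
- rewrite -[LHS]/(qtens _ q _) qtens_tens /= /diag_fun big_ord1.
  by rewrite !mxE !eqxx !mulr1 mul1r.
Qed.
End Bridge.

(** * Factors and linkage in terms of slots *)

Section Dictionary.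
Variable F : fieldType.
Implicit Types (q p : qform F) (s t : seq F) (b : F).

Lemma qtens_bpfister s q :
  qiso (of_qform (qtens (bpfister s) q)) (pform s (of_qform q)).
Proof.
elim: s => [|a s IH]; first exact: qtens_bdiag1.
exact: qiso_trans (qtens_btens_diag _ _ _) (dbl_iso a IH).
Qed.

Lemma of_qform_qbin b : qiso (of_qform (qbin b)) (bin_space b).
Proof.
exists (fun x : 'rV[F]_2 => (x 0 0, x 0 1)), (fun z => \row_i if i == 0 then z.1 else z.2).
split=> [a x y|x|[x y]|x] //=.
- by apply: injective_projections; rewrite /= !mxE.
- apply/rowP=> -[[|[|//]] lti]; rewrite mxE /=; congr (x 0 _); exact: val_inj.
- by rewrite !mxE.
Qed.

Lemma pform_qbin s b :
  qiso (of_qform (qtens (bpfister s) (qbin b))) (pform s (bin_space b)).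
Proof. exact: qiso_trans (qtens_bpfister _ _) (pform_iso s (of_qform_qbin b)). Qed.

Lemma is_qpfisterP n p : is_qpfister n p <->
  exists s b, [/\ (size s).+1 = n, 0 \notin s & qiso (of_qform p) (pform s (bin_space b))].
Proof.
split=> -[s [b [sn s0 i]]]; exists s, b; split=> //.
  by move/qisometricP: i => i; apply: qiso_trans i (pform_qbin _ _).
by apply/qisometricP; apply: qiso_trans i (qiso_sym (pform_qbin _ _)).
Qed.

Lemma is_qpfister_qbin b : is_qpfister 1 (qbin b).
Proof. by apply/is_qpfisterP; exists [::], b; split=> //; apply: of_qform_qbin. Qed.

Lemma qfactorP m n q p : qfactor m n q p <-> (m <= n)%N /\
  exists s, [/\ size s = (n - m)%N, 0 \notin s & qiso (of_qform p) (pform s (of_qform q))].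
Proof.
split=> -[mn]; last first.
  move=> [s [sn s0 i]]; split=> //; exists (bpfister s).
    by exists s; split=> //; exists idfun => //; exists id.
  by apply/qisometricP; apply: qiso_trans i (qiso_sym (qtens_bpfister _ _)).
move=> [B [s [sn s0 Bs]] /qisometricP pB]; split=> //; exists s; split=> //.
apply: qiso_trans pB _; apply: qiso_trans (qtens_bisometric _ Bs) _.
exact: qtens_bpfister.
Qed.

Lemma insep_linked_pform n p1 p2 t b1 b2 : size t = n -> 0 \notin t ->
  qiso (of_qform p1) (pform t (bin_space b1)) -> qiso (of_qform p2) (pform t (bin_space b2)) ->
  insep_linked n n.+1 p1 p2.
Proof.
move=> tn t0 i1 i2.
have fac p b : qiso (of_qform p) (pform t (bin_space b)) -> bfactor n n.+1 (bpfister t) p.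
  move=> i; split=> //; exists (qbin b); first by rewrite subSnn; apply: is_qpfister_qbin.
  by apply/qisometricP; apply: qiso_trans i (qiso_sym (pform_qbin _ _)).
exists (bpfister t); split; [|exact: fac i1|exact: fac i2].
by exists t; split=> //; exists idfun => //; exists id.
Qed.

Lemma tot_sep_linked1_insep_linked n p1 p2 : 2%N \in [pchar F] ->
  sep_linked n n.+1 p1 p2 -> tot_sep_linked 1 n.+1 p1 p2 -> insep_linked n n.+1 p1 p2.
Proof.
move=> charF2 [q [/is_qpfisterP[s [b [sn s0 qs]]] /qfactorP[_ [s1 [sz1 s1_0 i1]]]
  /qfactorP[_ [s2 [sz2 s2_0 i2]]]]] tot.
rewrite subSnn in sz1 sz2.
case: s1 s2 sz1 sz2 i1 i2 s1_0 s2_0 => [|a []] // [|d []] // _ _ i1 i2.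
rewrite !inE ![0 == _]eq_sym => a0 d0.
have {}i1 := qiso_trans i1 (dbl_iso a qs); have {}i2 := qiso_trans i2 (dbl_iso d qs).
have [|t [b1 [b2 [tn t0 e1 e2]]]] := common_bins_share_slots charF2 (b := b) s0 a0 d0.
  move=> c t it tn t0; have st : size t = (n.+1 - 1)%N by rewrite tn sn subn1.
  have fac1 : qfactor 1 n.+1 (qbin c) p1.
    apply/qfactorP; split=> //; exists t; split=> //.
    apply: qiso_trans i1 (qiso_trans it _); apply: pform_iso.
    exact: qiso_sym (of_qform_qbin _).
  have /qfactorP[_ [t' [_ _ it']]] := (tot _ (is_qpfister_qbin c)).1 fac1.
  apply: contains_bin_iso (contains_bin_pform t' c).
  apply: qiso_trans (qiso_trans (qiso_sym _) i2); last exact: it'.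
  by apply: pform_iso; apply: qiso_sym; apply: of_qform_qbin.
by apply: (insep_linked_pform (t := t)) (qiso_trans i1 e1) (qiso_trans i2 e2); rewrite ?tn.
Qed.

Lemma is_qpfister_qtens q n s : is_qpfister n q -> 0 \notin s ->
  is_qpfister (size s + n) (qtens (bpfister s) q).
Proof.
move=> /is_qpfisterP[t [b [tn t0 i]]] s0; apply/is_qpfisterP.
exists (s ++ t), b; split; first by rewrite size_cat -tn addnS.
  by rewrite mem_cat negb_or s0.
apply: qiso_trans (qtens_bpfister _ _) _; rewrite /pform foldr_cat.
exact: pform_iso.
Qed.

(** A one-fold factor q of an (n+2)-fold form is a factor of an (n+1)-fold factor,
    obtained by dropping one bilinear slot; the latter is then common to both. *)
Lemma tot_sep_linked1 n p1 p2 : tot_sep_linked n.+1 n.+2 p1 p2 ->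
  tot_sep_linked 1 n.+2 p1 p2.
Proof.
have half p p' q : is_qpfister 1 q ->
    (forall r, is_qpfister n.+1 r ->
       qfactor n.+1 n.+2 r p -> qfactor n.+1 n.+2 r p') ->
    qfactor 1 n.+2 q p -> qfactor 1 n.+2 q p'.
  move=> q1 tot /qfactorP[_ [s [sn s0 i]]]; apply/qfactorP; split=> //.
  case: s sn s0 i => // a s; rewrite subn1 /= => -[sn]; rewrite inE negb_or eq_sym.
  case/andP=> a0 s0 i.
  have r1 : is_qpfister n.+1 (qtens (bpfister s) q).
    by rewrite -addn1 -sn; apply: is_qpfister_qtens.
  have /tot : qfactor n.+1 n.+2 (qtens (bpfister s) q) p.
    apply/qfactorP; split=> //; exists [:: a]; split; rewrite ?subSnn //.
      by rewrite inE eq_sym.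
    by apply: qiso_trans i (dbl_iso a (qiso_sym (qtens_bpfister _ _))).
  move=> /(_ r1)/qfactorP[_ [t [tn t0 i']]]; exists (t ++ s); split.
  - by rewrite size_cat tn sn subSnn.
  - by rewrite mem_cat negb_or t0.
  by rewrite /pform foldr_cat; apply: qiso_trans i' (pform_iso t (qtens_bpfister _ _)).
by move=> tot q q1; split; apply: half => // r r1 /(tot r r1).
Qed.

Lemma tot_sep_linked_sep_linked n p1 p2 : is_qpfister n.+2 p1 ->
  tot_sep_linked n.+1 n.+2 p1 p2 -> sep_linked n.+1 n.+2 p1 p2.
Proof.
move=> /is_qpfisterP[[|a s] [b [//= [sn]]]]; rewrite inE negb_or eq_sym.
case/andP=> a0 s0 i tot.
have r1 : is_qpfister n.+1 (qtens (bpfister s) (qbin b)).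
  by rewrite -addn1 -sn; apply: is_qpfister_qtens (is_qpfister_qbin b) s0.
have fac1 : qfactor n.+1 n.+2 (qtens (bpfister s) (qbin b)) p1.
  apply/qfactorP; split=> //; exists [:: a]; split; rewrite ?subSnn //.
    by rewrite inE eq_sym.
  exact: qiso_trans i (dbl_iso a (qiso_sym (pform_qbin _ _))).
by exists (qtens (bpfister s) (qbin b)); split=> //; apply/tot.
Qed.
End Dictionary.

Theorem corollary3p5 (F : fieldType) (charF2 : 2%N \in [pchar F]) (n : nat)
    (n_ge2 : (2 <= n)%N) :
  (forall p1 p2 : qform F, is_qpfister n p1 -> is_qpfister n p2 ->
     sep_linked n.-1 n p1 p2 -> tot_sep_linked 1 n p1 p2 ->
     insep_linked n.-1 n p1 p2) /\
  (forall p1 p2 : qform F, is_qpfister n p1 -> is_qpfister n p2 ->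
     tot_sep_linked n.-1 n p1 p2 ->
     insep_linked n.-1 n p1 p2).
Proof.
case: n n_ge2 => [|[|n]] // _; split=> p1 p2 p1n p2n.
  exact: tot_sep_linked1_insep_linked.
move=> tot; apply: tot_sep_linked1_insep_linked => //.
  exact: tot_sep_linked_sep_linked.
exact: tot_sep_linked1.
Qed.
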